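(* Let $p$ be a prime, $n\ge 1$ an integer and $q=p^n$. Let $\zeta$ be a primitive element of $\mathbb{F}_q$ and let $\lambda\in\mathbb{F}_q$ be such that $\mathbb{F}_q=\mathbb{F}_p(\lambda)$, so that $(1,\lambda,\ldots,\lambda^{n-1})$ is a basis of $\mathbb{F}_q$ over $\mathbb{F}_p$. Define $f:\mathbb{F}_q\to\mathbb{F}_q$ by $$f(\zeta^x)=x_0+x_1\lambda+\cdots+x_{n-1}\lambda^{n-1},\qquad x=0,1,\ldots,q-2,$$ where $x=x_0+x_1p+\cdots+x_{n-1}p^{n-1}$ with integers $0\le x_0,x_1,\ldots,x_{n-1}<p$, and $$f(0)=-1-\lambda-\cdots-\lambda^{n-1}.$$ Then the permutation $f$ (identified with the unique polynomial of degree at most $q-1$ representing it) satisfies $$\deg(f)\ge q-\frac{q}{p}-1,\qquad \mathrm{w}(f)\ge q-\frac{q}{p},\qquad \mathrm{AddInd}(f)\ge\frac{p^n}{n+2},$$ and, if $p>2$, $$\mathrm{Crk}(f)\ge p^n-3(2p)^{n/2}.$$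
   Context: Degree and weight: every map $f:\mathbb{F}_q\to\mathbb{F}_q$ coincides on $\mathbb{F}_q$ with a unique polynomial $P_f\in\mathbb{F}_q[x]$ of degree at most $q-1$; $\deg(f)$ is the degree of $P_f$ and the weight $\mathrm{w}(f)$ is the number of nonzero coefficients of $P_f$. Additive index: view $\mathbb{F}_q$ as an $n$-dimensional vector space over $\mathbb{F}_p$. A map $f:\mathbb{F}_q\to\mathbb{F}_q$ is of codimension at most $k$ ($0\le k\le n$) if there are an $\mathbb{F}_p$-linear map $M:\mathbb{F}_q\to\mathbb{F}_q$ (equivalently, a map induced by a linearised polynomial $\sum_j a_jX^{p^j}$, $a_j\in\mathbb{F}_q$) and an $\mathbb{F}_p$-subspace $U$ of $\mathbb{F}_q$ of dimension $n-k$ such that $f-M$ is constant on each coset of $U$. The codimension $\mathrm{codim}\, f$ is the smallest such $k$, and $\mathrm{AddInd}(f)=p^{\mathrm{codim}\, f}$. Carlitz rank: by a theorem of Carlitz, for $q\ge 3$ the group of permutations of $\mathbb{F}_q$ under composition is generated by the inversion map ($0\mapsto 0$, $x\mapsto x^{-1}$ for $x\ne 0$; i.e. $x\mapsto x^{q-2}$) and all affine maps $x\mapsto \alpha x+\beta$ with $\alpha,\beta\in\mathbb{F}_q$, $\alpha\neq 0$. The Carlitz rank $\mathrm{Crk}(f)$ of a permutation $f$ of $\mathbb{F}_q$ is the minimum number of inversions needed to write $f$ as a composition of inversions and such affine maps. *)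

(* Defs.v *)
From HB Require Import structures.
From mathcomp Require Import all_boot all_order all_algebra all_fingroup all_field.
From mathcomp Require Import boolp.

Set Implicit Arguments.
Unset Strict Implicit.
Unset Printing Implicit Defensive.

Import GRing.Theory.
Local Open Scope ring_scope.

Section Representation.
Variable F : finFieldType.
Implicit Types (f : F -> F) (P : {poly F}).

Definition represents f P := (size P <= #|F|)%N && [forall x, P.[x] == f x].

Lemma represents_exists f : exists P, represents f P.
Proof.
have q0 : (0 < #|F|)%N by apply/card_gt0P; exists 0.
have q1 : (1 < #|F|)%N := finNzRing_gt1 F.
exists (\sum_c f c *: (1 - ('X - c%:P) ^+ #|F|.-1)); apply/andP; split.
  apply: (leq_trans (size_sum _ _ _)); apply/bigmax_leqP => c _.
  apply: (leq_trans (size_scale_leq _ _)); apply: (leq_trans (size_polyD _ _)).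
  by rewrite size_polyN size_exp_XsubC size_poly1 prednK // geq_max q0 leqnn.
apply/forallP => x; rewrite horner_sum (bigD1 x) //= big1 ?addr0.
  rewrite !hornerE subrr expr0n.
  by case: #|F| q1 => [|[|m]] //= _; rewrite subr0 mulr1.
move=> c ncx; rewrite !hornerE.
have nz : x - c != 0 by rewrite subr_eq0 eq_sym.
have -> : (x - c) ^+ #|F|.-1 = 1.
  by apply: (mulfI nz); rewrite -exprS prednK // expf_card mulr1.
by rewrite subrr mulr0.
Qed.

(* the polynomial P_f of degree at most q - 1 with P_f(x) = f(x) on F *)
Definition poly_of f : {poly F} := xchoose (represents_exists f).

Lemma poly_ofP f : represents f (poly_of f).
Proof. exact: xchooseP. Qed.

Lemma poly_of_unique f P : represents f P -> P = poly_of f.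
Proof.
move=> /andP[sP /forallP eP]; have /andP[sQ /forallP eQ] := poly_ofP f.
apply/eqP; rewrite -subr_eq0; apply/negP => /negP nz.
have rt : all (root (P - poly_of f)) (enum F).
  apply/allP => x _; rewrite rootE hornerD hornerN.
  by rewrite (eqP (eP x)) (eqP (eQ x)) subrr.
have := max_poly_roots nz rt (enum_uniq F).
rewrite -cardE ltnNge => /negP[]; apply: (leq_trans (size_polyD _ _)).
by rewrite size_polyN geq_max sP sQ.
Qed.

(* The zero map gets degree 0. *)
Definition map_degree f : nat := (size (poly_of f)).-1.

Definition map_weight f : nat := count (fun c => c != 0) (poly_of f).

End Representation.

Section AdditiveIndex.
Variables (F : finFieldType) (p : nat) (hp : p \in [pchar F]).
Local Notation L := (pPrimeCharType hp).

Definition codim_at_most (f : F -> F) (k : nat) : Prop :=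
  (k <= \dim {: L})%N /\
  exists (M : {linear L -> L}) (U : {vspace L}),
    \dim U = (\dim {: L} - k)%N /\
    forall x y : L, x - y \in U -> f x - M x = f y - M y.

Lemma codim_exists f : exists k, `[< codim_at_most f k >].
Proof.
exists (\dim {: L}); apply/asboolP; split=> //.
exists \0, 0%VS; split; first by rewrite dimv0 subnn.
by move=> x y; rewrite memv0 subr_eq0 => /eqP->.
Qed.

Definition codim (f : F -> F) : nat := ex_minn (codim_exists f).

Definition add_index (f : F -> F) : nat := (p ^ codim f)%N.

End AdditiveIndex.

Section CarlitzRank.
Variable F : finFieldType.
Implicit Types (f g s : {perm F}) (a b x y : F).

(* 0^-1 = 0 in F, so this map fixes 0. *)
Definition inversion : {perm F} := perm (@invr_inj F).

Lemma inversionE x : inversion x = x^-1.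
Proof. exact: permE. Qed.

Definition affine s := exists a b, a != 0 /\ forall x, s x = a * x + b.

(* f is a composition of affine maps and exactly k inversions, in any order;
   (g * s)%g is g followed by s. *)
Inductive inversion_word : nat -> {perm F} -> Prop :=
| word_id : inversion_word 0 1%g
| word_affine k g s : affine s -> inversion_word k g -> inversion_word k (g * s)%g
| word_inversion k g : inversion_word k g -> inversion_word k.+1 (g * inversion)%g.

Lemma word_mul j k f g :
  inversion_word j f -> inversion_word k g -> inversion_word (k + j) (f * g)%g.
Proof.
move=> wf; elim=> {k g} [|k g s sa _ IH|k g _ IH].
- by rewrite mulg1.
- by rewrite mulgA; apply: word_affine.
- by rewrite mulgA addSn; apply: word_inversion.
Qed.

Lemma affine_ex a b : a != 0 -> exists2 s, affine s & forall x, s x = a * x + b.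
Proof.
move=> a0; have inj : injective (fun x => a * x + b).
  by move=> x y /addIr /(mulfI a0).
have E x : perm inj x = a * x + b by rewrite permE.
by exists (perm inj) => //; exists a, b.
Qed.

Lemma word_tperm x y : x != y -> inversion_word 3 (tperm x y).
Proof.
move=> nxy; pose a := y - x.
have a0 : a != 0 by rewrite subr_eq0 eq_sym.
have [s1 A1 E1] := affine_ex (- y) (oner_neq0 F).
have [s2 A2 E2] := affine_ex a^-1 (oner_neq0 F).
have [s3 A3 E3] := affine_ex (- a) (oner_neq0 F).
have [s4 A4 E4] : exists2 s, affine s & forall z, s z = - a ^+ 2 * z + x.
  by apply: affine_ex; rewrite oppr_eq0 expf_eq0.
have -> : tperm x y
    = (1 * s1 * inversion * s2 * inversion * s3 * inversion * s4)%g.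
  apply/permP => z; rewrite mul1g !permM E4 inversionE E3 inversionE E2
    inversionE E1 !mul1r.
  case: (tpermP x y z) => [->|->|/eqP zx /eqP zy].
  - have -> : x - y = - a by rewrite opprB.
    by rewrite invrN addNr invr0 add0r invrN mulrNN expr2 mulfK // subrK.
  - by rewrite subrr invr0 add0r invrK subrr invr0 mulr0 add0r.
  have zy0 : z - y != 0 by rewrite subr_eq0.
  have zx0 : z - x != 0 by rewrite subr_eq0.
  have Ez : z - y + a = z - x by rewrite /a addrA subrK.
  have -> : (z - y)^-1 + a^-1 = (z - x) / (a * (z - y)).
    rewrite -Ez; apply: (mulIf (mulf_neq0 a0 zy0)); rewrite mulfVK ?mulf_neq0 //.
    by rewrite mulrDl mulrCA mulVf // mulr1 mulKf // addrC.
  have -> : ((z - x) / (a * (z - y)))^-1 - a = - (a ^+ 2 / (z - x)).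
    rewrite invf_div; apply: (mulIf zx0); rewrite mulrBl mulNr !mulfVK //.
    by rewrite -mulrBr expr2 -mulrN -Ez opprD addrA subrr add0r.
  by rewrite invrN invf_div mulrNN mulrC mulfVK ?expf_neq0 // subrK.
by apply/word_affine/word_inversion/word_affine/word_inversion/word_affine
  /word_inversion/word_affine/word_id.
Qed.

(* Carlitz's theorem; with 0 |-> 0 it also holds for q = 2. *)
Lemma carlitz f : exists k, `[< inversion_word k f >].
Proof.
suff [k wk] : exists k, inversion_word k f by exists k; apply/asboolP.
have [ts -> nts] := prod_tpermP f.
elim: ts nts => [_|[x y] ts IH] /=; first by rewrite big_nil; exists 0%N; apply: word_id.
rewrite big_cons /= => /andP[nxy /IH[k wk]].
by exists (k + 3)%N; apply: word_mul wk; apply: word_tperm.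
Qed.

Definition carlitz_rank f : nat := ex_minn (carlitz f).

End CarlitzRank.

(* Main.v *)
Require Import Defs.
From mathcomp Require Import all_boot all_order all_algebra all_fingroup all_field.
From mathcomp Require Import reals exp.
From mathcomp Require Import boolp zify ring lra.
Import Order.TTheory GRing.Theory Num.Theory.
Local Open Scope ring_scope.

(* Write e(a) for the sum of a_i lambda^i over the base-p digits a_i of a. Then
   e is injective on [0, q), f (zeta^a) = e(a) for a <= q - 2 and f 0 = e(q - 1).

   Weight and degree: with r = q / p, the function
   f (zeta^r y) - f y - lambda^(n-1) vanishes at q - 1 - r consecutive powers of
   zeta. Pairing these values with the coefficients of the polynomial whose roots
   are the zeta^j, 0 < j < q - 1 in the support of P_f, isolates the constant term
   unless P_f has weight at least q - r.

   Additive index: f (zeta y) = f y + 1 outside at most r + 1 points. If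
   f (y + u) = f y + M u for u in U, then the translates by U of the set where this
   holds are pairwise disjoint, so |U| (q - r - 1) <= q.

   Carlitz rank: k inversions yield a fractional linear map off k points. For fixed
   t, v the equations f x = R x and f (t x) = f x + v = R (t x) have at most two
   common solutions, and the pairs (x, t x) are sorted into (2p)^n classes by the
   differences of their digit vectors. *)

(** * Base-[p] digits and the map [counter] *)

Lemma digit_expansion (p n a : nat) : (0 < p)%N -> (a < p ^ n)%N ->
  a = (\sum_(i < n) (a %/ p ^ i %% p) * p ^ i)%N.
Proof.
(* Passing to [a] modulo [p ^ n] frees the induction from the bound on [a]. *)
move=> p0 an; rewrite -[LHS](modn_small an) {an}.
elim: n => [|n IH]; first by rewrite big_ord0 expn0 modn1.
rewrite big_ord_recr /= -IH {IH}.
have q0 : (0 < p ^ n)%N by rewrite expn_gt0 p0.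
rewrite {1}(divn_eq a (p ^ n)) {1}(divn_eq (a %/ p ^ n) p) mulnDl -mulnA -expnS.
rewrite -addnA modnMDl modn_small 1?addnC // expnS.
have := ltn_pmod a q0; have := ltn_pmod (a %/ p ^ n) p0.
by move: (_ %% _)%N (_ %% _)%N => u v hu hv; nia.
Qed.

Section Counter.
Variables (F : finFieldType) (p : nat) (charFp : p \in [pchar F]).
Variable lambda : F.

(* In characteristic p the quotient a %/ p ^ i may replace the i-th digit of a. *)
Definition counter (n a : nat) : F := \sum_(i < n) (a %/ p ^ i)%:R * lambda ^+ i.

Let p_prime : prime p := pcharf_prime charFp.

Lemma counter0 (n : nat) : counter n 0 = 0.
Proof. by rewrite /counter big1 // => i _; rewrite div0n mul0r. Qed.

Lemma natr_modp (a : nat) : (a %% p)%:R = a%:R :> F.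
Proof. by rewrite {2}(divn_eq a p) natrD natrM (pcharf0 charFp) mulr0 add0r. Qed.

Lemma counter_digits (n a : nat) :
  counter n a = \sum_(i < n) (a %/ p ^ i %% p)%:R * lambda ^+ i.
Proof. by apply: eq_bigr => i _; rewrite natr_modp. Qed.

(** There is no carry: if some [p ^ i] with [i > 0] divided [a.+1], so would [p]. Hence only the
    quotient by [p ^ 0] changes. *)
Lemma counterS (n a : nat) : (0 < n)%N -> ~~ (p %| a.+1)%N ->
  counter n a.+1 = counter n a + 1.
Proof.
case: n => // m _ nd; rewrite /counter.
rewrite !big_ord_recl /= !expn0 !divn1 expr0 !mulr1 -natr1 addrAC; congr (_ + _ + _).
apply: eq_bigr => i _; rewrite divnS ?expn_gt0 ?prime_gt0 //.
case: (boolP (_ ^ _ %| _)%N) => // /(dvdn_trans _) h.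
by rewrite h ?dvdn_exp // in nd.
Qed.

(** The [i]-th quotient grows by [p ^ (n.-1 - i)], which is zero in [F] unless [i = n.-1]. This
    holds for every [a], also when the top digit wraps around. *)
Lemma counter_top (n a : nat) : (0 < n)%N ->
  counter n (a + p ^ n.-1) = counter n a + lambda ^+ n.-1.
Proof.
case: n => // m /= _; rewrite /counter.
have p0 := prime_gt0 p_prime.
rewrite !big_ord_recr /= divnDr // divnn expn_gt0 p0 natrD mulrDl mul1r addrA.
congr (_ + _ + _); apply: eq_bigr => i _ /=.
rewrite divnDr ?dvdn_exp2l ?(ltnW (ltn_ord i)) // natrD.
rewrite -expnB ?(ltnW (ltn_ord i)) ?prime_gt0 //.
have : (0 < m - i)%N by rewrite subn_gt0.
by case: (m - i)%N => // k _; rewrite expnS natrM (pcharf0 charFp) mul0r addr0.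
Qed.

(** All digits of [p ^ n - 1] equal [p - 1], which is -1 in [F]; this makes the prescribed value of
    f at 0 equal to e(q - 1). *)
Lemma counter_max (n : nat) : counter n (p ^ n).-1 = - \sum_(i < n) lambda ^+ i.
Proof.
have p0 := prime_gt0 p_prime.
rewrite /counter -sumrN; apply: eq_bigr => i _; rewrite -mulN1r; congr (_ * _).
have pi0 : (0 < p ^ i)%N by rewrite expn_gt0 p0.
have := divnS (p ^ n).-1 pi0.
rewrite prednK ?expn_gt0 ?p0 // dvdn_exp2l ?(ltnW (ltn_ord i)) // add1n => eS.
apply/eqP; rewrite -addr_eq0 natr1 -eS -expnB ?(ltnW (ltn_ord i)) //.
by rewrite -(dvdn_pcharf charFp) dvdn_exp // subn_gt0.
Qed.

Variable n : nat.
Hypothesis card_F : #|F| = (p ^ n)%N.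
Hypothesis lambda_gen : <<1; (lambda : pPrimeCharType charFp)>>%VS = fullv.

Lemma dim_pPrimeChar : \dim {: pPrimeCharType charFp} = n.
Proof.
by rewrite pprimeChar_dimf; have /= -> := card_F; rewrite pfactorK.
Qed.

(** The digit differences are the coefficients of a polynomial over the prime field, of degree less
    than [n], with root [lambda]. Since [lambda] has degree [n], they all vanish, so the digits
    agree modulo [p]. *)
Lemma counter_inj (a b : nat) : (a < p ^ n)%N -> (b < p ^ n)%N ->
  counter n a = counter n b -> a = b.
Proof.
move=> an bn eab; have p0 := prime_gt0 p_prime.
rewrite (digit_expansion _ _ _ p0 an) (digit_expansion _ _ _ p0 bn).
pose L := pPrimeCharType charFp.
pose P : {poly L} := \poly_(i < n) ((a %/ p ^ i)%:R - (b %/ p ^ i)%:R).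
have deg : adjoin_degree 1 (lambda : L) = n.
  have := dim_Fadjoin 1 (lambda : L).
  by rewrite lambda_gen dim_pPrimeChar dimv1 muln1.
have P0 : P == 0.
  rewrite -(@root_small_adjoin_poly _ L 1%AS (lambda : L)).
  - rewrite rootE horner_poly; apply/eqP.
    under eq_bigr do rewrite mulrBl.
    by rewrite sumrB; apply/eqP; rewrite subr_eq0; apply/eqP.
  - apply/polyOverP => i; rewrite coef_poly; case: ifP => _; last exact: rpred0.
    by rewrite rpredB // rpred_nat.
  - by rewrite deg size_poly.
apply: eq_bigr => i _; congr (_ * _)%N.
have /eqP := congr1 (fun Q : {poly L} => Q`_i) (eqP P0).
rewrite coef_poly ltn_ord coef0 subr_eq0 => /eqP eqi.
clear P P0; wlog le : a b {an bn eab} eqi / (b %/ p ^ i <= a %/ p ^ i)%N.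
  by move=> W; case/orP: (leq_total (b %/ p ^ i) (a %/ p ^ i)) => h;
    [|symmetry]; apply: W.
apply/eqP; rewrite eqn_mod_dvd // (dvdn_pcharf charFp) natrB //.
by rewrite subr_eq0; apply/eqP.
Qed.

End Counter.

(** * Weight and degree *)

Lemma map_weight_gt_shift (F : finFieldType) (zeta : F) (f : F -> F)
    (t N : nat) (c : F) :
  (#|F|.-1).-primitive_root zeta -> f 0 != 0 -> c != 0 ->
  (forall x, (x < N)%N -> f (zeta ^+ (x + t)) = f (zeta ^+ x) + c) ->
  (N < map_weight f)%N.
Proof.
move=> prim f0 c0 shift; rewrite /map_weight.
have /andP[szP /forallP eP] := poly_ofP f.
set P := poly_of f in szP eP *.
have q1 : (1 < #|F|)%N := finNzRing_gt1 F.
have : #|F| = (1 + (#|F| - 2) + 1)%N by lia.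
set m := (#|F| - 2)%N => qm.
(* Indices 0 and q - 1 are left out because the factor [zeta ^+ (j * t) - 1] vanishes there. As
   [f 0 != 0], index 0 lies in the support as well, whence the strict inequality in [wJ]. *)
pose J := [seq j <- iota 1 m | P`_j != 0].
have wJ : (size J < count (fun c => c != 0%R) P)%N.
  have -> : count (fun c => c != 0) P = count (fun i => P`_i != 0) (iota 0 #|F|).
    rewrite -{1}(mkseq_nth 0 P) count_map -(subnKC szP) iotaD count_cat.
    rewrite [X in (_ + X)%N](_ : _ = 0)%N ?addn0 //.
    apply/eqP; rewrite -leqn0 leqNgt -has_count; apply/hasPn => i.
    by rewrite mem_iota => /andP[h _]; rewrite nth_default // eqxx.
  have -> : iota 0 #|F| = 0%N :: iota 1 m ++ [:: m.+1] by rewrite qm !iotaD.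
  by rewrite /= count_cat -horner_coef0 (eqP (eP 0)) f0 size_filter ltnS leq_addr.
apply: leq_trans wJ; rewrite ltnS leqNgt; apply/negP => sJ.
(* With fewer than [N] roots, [A] has at most [N] coefficients, so they can weight the shift
   equations. The weighted sum is [c * A.[1]]; expanding [f] shows that it is 0, although no
   [zeta ^+ j] with [j] in [J] is 1. *)
pose A := \prod_(z <- [seq zeta ^+ j | j <- J]) ('X - z%:P).
have szA : (size A <= N)%N by rewrite size_prod_XsubC size_map.
have : c * A.[1] = 0.
  transitivity (\sum_(x < size A) A`_x * (f (zeta ^+ (x + t)) - f (zeta ^+ x))).
    rewrite horner_coef mulr_sumr; apply: eq_bigr => x _.
    rewrite shift ?(leq_trans (ltn_ord x)) // expr1n mulr1 [_ + c]addrC addrK.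
    by rewrite mulrC.
  transitivity (\sum_(j < #|F|) P`_j * (zeta ^+ (j * t) - 1) * A.[zeta ^+ j]).
    under eq_bigr => x _.
      rewrite -!(eqP (eP _)) !(horner_coef_wide _ szP) -sumrB mulr_sumr.
      over.
    rewrite exchange_big; apply: eq_bigr => j _ /=.
    rewrite horner_coef mulr_sumr; apply: eq_bigr => x _.
    rewrite -!exprM mulnDl exprD (mulnC t) (mulnC x); ring.
  apply: big1 => j _.
  have [->|Pj] := eqVneq P`_j 0; first by rewrite !mul0r.
  have [j0|j0] := eqVneq (j : nat) 0%N; first by rewrite j0 mul0n subrr mulr0 mul0r.
  have [jq|jq] := eqVneq (j : nat) #|F|.-1.
    by rewrite exprM jq (prim_expr_order prim) expr1n subrr mulr0 mul0r.
  suff /rootP-> : root A (zeta ^+ j) by rewrite mulr0.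
  rewrite root_prod_XsubC map_f // mem_filter Pj mem_iota.
  by have := ltn_ord j; lia.
move/eqP; rewrite mulf_eq0 (negbTE c0) /= -rootE.
rewrite root_prod_XsubC => /mapP[j]; rewrite mem_filter mem_iota => /andP[_ jm] /esym/eqP.
by rewrite -(prim_order_dvd prim) => /dvdn_leq; lia.
Qed.

Lemma map_weight_le_degree (F : finFieldType) (f : F -> F) :
  (map_weight f <= (map_degree f).+1)%N.
Proof. by rewrite (leq_trans (count_size _ _)) // /map_degree leqSpred. Qed.

(** * Additive index *)

(* If x and x + u lie in the set and u in U, then f (zeta * (x + u)) and
   f (zeta * x + u) agree, so zeta * u = u. *)
Lemma card_shift_set (F : finFieldType) (p : nat) (charFp : p \in [pchar F])
    (f : F -> F) (zeta c : F) (M : {linear pPrimeCharType charFp -> pPrimeCharType charFp})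
    (U : {vspace pPrimeCharType charFp}) :
  injective f -> c != 0 ->
  (forall x y : pPrimeCharType charFp, x - y \in U -> f x - M x = f y - M y) ->
  (p ^ \dim U * #|[set x : F | f (zeta * x) == f x + c]%R| <= #|F|)%N.
Proof.
move=> injf c0 fM; set A := [set x | _]; set L := pPrimeCharType charFp in M U fM *.
have fD (x u : L) : u \in U -> f (x + u) = f x + M u.
  move=> uU; have := fM (x + u) x; rewrite addrAC subrr add0r => /(_ uU).
  by rewrite raddfD => /eqP; rewrite subr_eq => /eqP->; rewrite addrA subrK.
pose B : {set F} := [set u : F | (u : L) \in U].
have cB : #|B| = (p ^ \dim U)%N.
  have := card_vspace U; rewrite card_Fp ?(pcharf_prime charFp) // => <-.
  by apply: eq_card => u; rewrite inE.
rewrite -cB -cardsX; apply: leq_trans (max_card [set u.1 + u.2 | u in setX B A]).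
rewrite card_in_imset // => -[u x] [v y] /setXP[/= + xA] /setXP[/= + yA].
rewrite !inE => uU vU exy.
have ey : y = x + (u - v) by rewrite addrA [x + u]addrC exy [v + y]addrC addrK.
have wU : (u - v : L) \in U by apply: rpredB.
suff w0 : u - v = 0.
  by move/eqP: (w0); rewrite subr_eq0 => /eqP->; rewrite ey w0 addr0.
move: xA yA; rewrite !inE ey mulrDr => /eqP xA /eqP.
rewrite (fD x) // addrAC -xA -fD // => /injf /addrI /eqP.
rewrite -subr_eq0 -{2}[u - v]mul1r -mulrBl mulf_eq0 => /orP[|/eqP//].
rewrite subr_eq0 => /eqP z1; move: xA; rewrite z1 mul1r -{1}[f x]addr0.
by move/addrI/eqP; rewrite eq_sym (negbTE c0).
Qed.

(** * Carlitz rank *)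

(** Denominators are cleared. An affine map creates no new exception; an inversion swaps numerator
    and denominator and adds at most one exception, the zero of [g]. *)
Lemma word_linear_fractional (F : finFieldType) (k : nat) (g : {perm F}) :
  inversion_word k g -> exists a b c d, a * d - b * c != 0 /\
    (#|[set x : F | g x * (c * x + d) != a * x + b]%R| <= k)%N.
Proof.
elim=> {k g} [|k g s [al [be [al0 sE]]] _ [a [b [c [d [D0 E]]]]]|k g _ [a [b [c [d [D0 E]]]]]].
- exists 1, 0, 0, 1; rewrite mulr0 subr0 mulr1 oner_neq0; split=> //.
  rewrite leqn0 cards_eq0; apply/eqP/setP => x; rewrite !inE perm1.
  by rewrite mul0r add0r mulr1 mul1r addr0 eqxx.
- exists (al * a + be * c), (al * b + be * d), c, d; split.
    have -> : (al * a + be * c) * d - (al * b + be * d) * c = al * (a * d - b * c).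
      by ring.
    by rewrite mulf_neq0.
  apply: leq_trans E; apply/subset_leq_card/subsetP => x; rewrite !inE permM sE.
  apply: contra => /eqP e.
  have -> : (al * g x + be) * (c * x + d) = al * (g x * (c * x + d)) + be * (c * x + d).
    by ring.
  by rewrite e; apply/eqP; ring.
- exists c, d, a, b; split.
    by rewrite [c * b]mulrC [d * a]mulrC -opprB oppr_eq0.
  rewrite -add1n -(cards1 ((g^-1)%g 0)).
  apply: leq_trans (leq_add (leqnn _) E).
  apply: leq_trans (leq_card_setU _ _).
  apply/subset_leq_card/subsetP => x; rewrite !inE permM inversionE => h.
  have [g0|g0] := eqVneq (g x) 0; first by rewrite -g0 permK eqxx.
  by rewrite orbC; apply/orP; left; apply: contra h => /eqP <-; rewrite mulKf.
Qed.

(** Eliminating [f x] leaves the quadratic [Q]. Its extreme coefficients [v * c ^+ 2 * t] and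
    [v * d ^+ 2] cannot both vanish, since [c = d = 0] contradicts the determinant. *)
Lemma card_fractional_shift (F : finFieldType) (f : F -> F) (a b c d t v : F)
    (S : {set F}) :
  a * d - b * c != 0 -> t != 0 -> v != 0 ->
  (forall x, x \in S -> f x * (c * x + d) = a * x + b
     /\ (f x + v) * (c * (t * x) + d) = a * (t * x) + b) ->
  (#|S| <= 2)%N.
Proof.
move=> D0 t0 v0 fS.
pose l (r s : F) : {poly F} := r%:P * 'X + s%:P.
pose Q := l a b * l (c * t) d + v%:P * (l c d * l (c * t) d)
   - l (a * t) b * l c d.
have szl r s : (size (l r s) <= 2)%N.
  rewrite (leq_trans (size_polyD _ _)) // geq_max size_polyC.
  case: (s != 0); rewrite ?andbT /= (leq_trans (size_polyMleq _ _)) //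
    size_polyX addn2 /= size_polyC; by case: (r != 0).
have szll r s r' s' : (size (l r s * l r' s')%R <= 3)%N.
  by rewrite (leq_trans (size_polyMleq _ _)) //; have := szl r s; have := szl r' s'; lia.
have szQ : (size Q <= 3)%N.
  rewrite (leq_trans (size_polyD _ _)) // size_polyN geq_max szll andbT.
  rewrite (leq_trans (size_polyD _ _)) // geq_max szll /= mul_polyC.
  by rewrite (leq_trans (size_scale_leq _ _)).
have Q0 : Q != 0.
  have QE : Q = (v * c ^+ 2 * t)%:P * 'X^2 +
     ((a * d + b * c * t + v * c * d + v * c * d * t - a * t * d - b * c)%:P * 'X
     + (v * d ^+ 2)%:P).
    by rewrite /Q /l !(polyCD, polyCN, polyCM, expr2); ring.
  apply/eqP => Qz; have := congr1 (fun P : {poly F} => P`_2) Qz.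
  have := congr1 (fun P : {poly F} => P`_0) Qz.
  rewrite /= QE !coefD !coefCM !coefC !coefX !coefXn ?coef0 /= !mulr0 !mulr1 !add0r !addr0.
  move/eqP; rewrite !mulf_eq0 (negbTE v0) orbb /= => /eqP dz /eqP.
  rewrite !mulf_eq0 (negbTE v0) (negbTE t0) orbb orbF /= => /eqP cz.
  by move: D0; rewrite dz cz !mulr0 subrr eqxx.
have := @max_poly_roots _ Q (enum S) Q0 _ (enum_uniq _).
rewrite -cardE => H; rewrite -ltnS; apply: leq_trans szQ; apply: H.
apply/allP => x; rewrite mem_enum => /fS[e1 e2]; rewrite rootE /Q /l !hornerE.
apply/eqP; move/eqP: e1; rewrite -subr_eq0 => /eqP e1.
move/eqP: e2; rewrite -subr_eq0 => /eqP e2.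
transitivity ((c * x + d) * 0 - 0 * (c * (t * x) + d)); last by rewrite mulr0 mul0r subrr.
by rewrite -{1}e2 -e1 /=; ring.
Qed.

Lemma card_fractional_agreement (F : finFieldType) (p : nat)
    (charFp : p \in [pchar F]) (n : nat) (lambda zeta : F) (f : F -> F)
    (lg : F -> nat) (a b c d : F) (S : {set F}) :
  (forall x, x != 0 -> x = zeta ^+ lg x) -> (forall x, (lg x < p ^ n)%N) ->
  (forall x, f x = counter F p lambda n (lg x)) -> injective f ->
  a * d - b * c != 0 ->
  (forall x, x \in S -> x != 0 /\ f x * (c * x + d) = a * x + b) ->
  (#|S| * #|S| <= 2 * (2 * p) ^ n + #|S|)%N.
Proof.
move=> xlg lgn flg injf D0 fS; have p0 := prime_gt0 (pcharf_prime charFp).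
pose T := [set u in setX S S | u.1 != u.2].
rewrite -cardsX.
have sT : setX S S \subset T :|: [set (x, x) | x in S].
  apply/subsetP => -[x y] xy; rewrite in_setU inE xy /=.
  have [e|//] := eqVneq x y; rewrite -e; apply/orP; right; apply: imset_f.
  by case/setXP: xy.
apply: leq_trans (subset_leq_card sT) _; apply: leq_trans (leq_card_setU _ _) _.
apply: leq_add (leq_imset_card _ _).
have dlt x y : (x %% p + p - y %% p < 2 * p)%N.
  by have := ltn_pmod x p0; have := ltn_pmod y p0; lia.
(* Adding [p] keeps digit differences nonnegative, so that truncated subtraction loses nothing. *)
have subp x y x' y' : (y < p -> y' < p ->
    x + p - y = x' + p - y' -> x + y' = x' + y)%N by clear; lia.
pose diff (u : F * F) := [ffun i : 'I_n =>
  Ordinal (dlt (lg u.2 %/ p ^ i)%N (lg u.1 %/ p ^ i)%N)].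
rewrite -sum1_card (partition_big diff predT) //=.
have -> : (2 * (2 * p) ^ n = \sum_(e : {ffun 'I_n -> 'I_(2 * p)}) 2)%N.
  by rewrite sum_nat_const card_ffun !card_ord mulnC.
apply: leq_sum => e _; rewrite sum1dep_card.
set C := [set u | _]; have [->|[u0 u0C]] := set_0Vmem C; first by rewrite cards0.
have CP u : u \in C -> [/\ u.1 \in S, u.2 \in S, u.1 != u.2 & diff u = e].
  by rewrite !inE => /andP[/andP[/andP[? ?] ?] /eqP].
have [/fS[u01 _] /fS[u02 _] nu0 du0] := CP _ u0C.
(* Equal digit differences mean equal differences of logarithms, hence equal ratios, and equal
   differences of values of [f]. *)
have rel u : u \in C ->
    u.2 = u0.2 / u0.1 * u.1 /\ f u.2 = f u.1 + (f u0.2 - f u0.1).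
  move=> /CP[/fS[u1 _] /fS[u2 _] nu du].
  have dig (i : 'I_n) : (lg u.2 %/ p ^ i %% p + lg u0.1 %/ p ^ i %% p =
                         lg u0.2 %/ p ^ i %% p + lg u.1 %/ p ^ i %% p)%N.
    apply: subp; rewrite ?ltn_pmod //.
    have := congr1 (fun g : {ffun 'I_n -> 'I_(2 * p)} => val (g i))
      (etrans du (esym du0)).
    by rewrite /= !ffunE.
  split.
    have es : (lg u.2 + lg u0.1 = lg u0.2 + lg u.1)%N.
      rewrite (digit_expansion _ _ _ p0 (lgn u.2)) (digit_expansion _ _ _ p0 (lgn u0.1)).
      rewrite (digit_expansion _ _ _ p0 (lgn u0.2)) (digit_expansion _ _ _ p0 (lgn u.1)).
      by rewrite -!big_split; apply: eq_bigr => i _ /=; rewrite -!mulnDl dig.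
    apply: (mulIf u01); rewrite mulrAC divfK //.
    by rewrite (xlg _ u2) (xlg _ u01) (xlg _ u02) (xlg _ u1) -!exprD es.
  apply/eqP; rewrite addrA -subr_eq opprK [f u.1 + _]addrC !flg !(counter_digits _ _ charFp).
  by rewrite -!big_split; apply/eqP/eq_bigr => i _ /=; rewrite -!mulrDl -!natrD dig.
rewrite -(card_in_imset (f := fst)); last first.
  move=> [x y] [x' y'] /rel[/= e1 _] /rel[/= e2 _] exx.
  by rewrite e1 e2 exx.
apply: (@card_fractional_shift _ f a b c d (u0.2 / u0.1) (f u0.2 - f u0.1)) => //.
- by rewrite mulf_neq0 ?invr_eq0.
- by rewrite subr_eq0 (inj_eq injf) eq_sym.
move=> x /imsetP[u uC ->]; have [u1 u2 _ _] := CP _ uC.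
by have [<- <-] := rel _ uC; split; [case: (fS _ u1)|case: (fS _ u2)].
Qed.

(** * Numerical estimates *)

(** If s > 3w - 1, then s(s - 1) > (3w - 1)(3w - 2) >= 2w^2. The extra 1 will absorb the point 0. *)
Lemma sqr_le_linear (R : realType) (w s : R) :
  2 <= w -> s * s <= 2 * (w * w) + s -> s + 1 <= 3 * w.
Proof. by move=> w2 h; rewrite leNgt; apply/negP => sw; nra. Qed.

(** A counterexample has [u >= 4], and the second inequality then forces [p = 2] and
    [p ^ n.-1 <= 2]. In these cases, [p ^ n] being 2 or 4, the bound [u <= p ^ n] suffices. *)
Lemma subspace_card_le (p n u : nat) : (1 < p)%N -> (0 < n)%N -> (u <= p ^ n)%N ->
  (u * (p ^ n - p ^ n.-1 - 1) <= p ^ n)%N -> (u <= n + 2)%N.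
Proof.
move=> p1; case: n => // n _; rewrite /= expnS => ub ineq.
rewrite leqNgt; apply/negP => nu.
have r0 : (0 < p ^ n)%N by rewrite expn_gt0 (ltnW p1).
have [p2 r2] : p = 2 /\ (p ^ n <= 2)%N by split; nia.
by move: ub nu r2; rewrite p2; case: n {r0 ineq} => [|[|n]]; rewrite ?expn0 ?expn1; lia.
Qed.

(** * The permutation [f] and its four bounds *)

Theorem theorem5 (R : realType) (p n q : nat) (F : finFieldType)
    (p_prime : prime p) (n_gt0 : (0 < n)%N) (q_def : q = (p ^ n)%N)
    (F_card : #|F| = q) (F_char : p \in [pchar F])
    (zeta : F) (zeta_prim : (q.-1).-primitive_root zeta)
    (lambda : F)
    (lambda_gen : <<1; (lambda : pPrimeCharType F_char)>>%VS = fullv)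
    (f : F -> F)
    (f_zeta : forall (x : nat) (d : 'I_n -> 'I_p), (x <= q - 2)%N ->
       x = (\sum_(i < n) d i * p ^ i)%N ->
       f (zeta ^+ x) = \sum_(i < n) (d i)%:R * lambda ^+ i)
    (f_0 : f 0 = - \sum_(i < n) lambda ^+ i) :
  exists f_inj : injective f,
    [/\ (q - q %/ p - 1 <= map_degree f)%N,
        (q - q %/ p <= map_weight f)%N,
        (p ^ n)%:R / (n + 2)%:R <= (add_index F_char f)%:R :> R
      & (2 < p)%N ->
        (p ^ n)%:R - 3%:R * (2 * p)%:R `^ (n%:R / 2%:R)
          <= (carlitz_rank (perm f_inj))%:R :> R].
Proof.
have p0 := prime_gt0 p_prime; have p1 := prime_gt1 p_prime.
have q1 : (1 < q)%N by rewrite -F_card finNzRing_gt1.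
have qr : (q = p * p ^ n.-1)%N by rewrite -expnS prednK.
have qp : (q %/ p = p ^ n.-1)%N by rewrite qr mulKn.
have r0 : (0 < p ^ n.-1)%N by rewrite expn_gt0 p0.
have F_card' : #|F| = (p ^ n)%N by rewrite F_card.
pose e := counter F p lambda n.
have e_inj a b : (a < q)%N -> (b < q)%N -> e a = e b -> a = b.
  by rewrite q_def; apply: (counter_inj _ _ F_char).
have fe a : (a <= q - 2)%N -> f (zeta ^+ a) = e a.
  move=> aq; have an : (a < p ^ n)%N by rewrite -q_def; lia.
  rewrite (f_zeta a (fun i => Ordinal (ltn_pmod (a %/ p ^ i)%N p0))) //=.
    by rewrite /e (counter_digits _ _ F_char).
  exact: digit_expansion.
have f0 : f 0 = e q.-1 by rewrite f_0 /e q_def counter_max.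
have e0 : e 0%N = 0 := counter0 _ _ _ _.
(* Setting the discrete logarithm of 0 to [q.-1] gives [f x = e (lg x)] on all of [F]. *)
have [lg lgP] : {lg : F -> nat & forall x,
    x = 0 /\ lg x = q.-1 \/ (lg x <= q - 2)%N /\ x = zeta ^+ lg x}.
  apply: (@choice _ _ (fun x l => x = 0 /\ l = q.-1 \/ (l <= q - 2)%N /\ x = zeta ^+ l)) => x.
  have [->|x0] := eqVneq x 0; first by exists q.-1; left.
  have xq : x ^+ q.-1 = 1.
    by apply: (mulfI x0); rewrite -exprS prednK ?(ltnW q1) // -F_card expf_card mulr1.
  have [i ->] := prim_rootP zeta_prim xq.
  by exists i; right; split => //; have := ltn_ord i; lia.
have lgq x : (lg x < q)%N by case: (lgP x) => -[]; lia.
have flg x : f x = e (lg x).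
  by case: (lgP x) => -[]; [move=> -> ->|move=> l {1}->; rewrite fe].
have xlg x : x != 0 -> x = zeta ^+ lg x.
  by case: (lgP x) => -[]; [move=> ->; rewrite eqxx|].
have f_inj : injective f.
  move=> x y; rewrite !flg => /(e_inj _ _ (lgq x) (lgq y)) l.
  by case: (lgP x) (lgP y) => -[hx ex] [] [hy ey]; rewrite ?hx ?hy //; try lia;
    rewrite ex ey l.
have wt : (q - q %/ p <= map_weight f)%N.
  apply: (@leq_trans (q - q %/ p - 1).+1); first by lia.
  apply: (@map_weight_gt_shift _ zeta f (p ^ n.-1) _ (lambda ^+ n.-1)).
  - by rewrite F_card.
  - by rewrite f0 -e0; apply/eqP => /e_inj; lia.
  - have := counter_top F p F_char lambda n 0 n_gt0; rewrite -/e e0 !add0r => <-.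
    by rewrite -e0; apply/eqP => /e_inj; nia.
  - by move=> x xN; rewrite !fe /e ?(counter_top _ _ F_char) //; nia.
exists f_inj; split => //.
- by have := map_weight_le_degree _ f; lia.
- rewrite /add_index /codim; case: ex_minnP => k /asboolP[kn [M [U [dimU fM]]]] _.
  move: kn dimU; rewrite (dim_pPrimeChar _ _ _ _ F_card') => kn dimU.
  have := card_shift_set _ _ _ _ zeta _ _ _ f_inj (oner_neq0 F) fM.
  set A := [set x | _]; rewrite dimU F_card => cA.
  have cardA : (q - p ^ n.-1 - 1 <= #|A|)%N.
    (* [B] collects the carries, where [p] divides the exponent plus one. The index stops before
       [p ^ n.-1 - 1], which would give exponent q - 1. With 0 and the wrap-around at
       [zeta ^+ (q - 2)] this makes at most [p ^ n.-1 + 1] exceptions. *)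
    pose B := [set zeta ^+ (i * p + p.-1) | i : 'I_(p ^ n.-1).-1].
    have sA : ~: A \subset 0 |: (zeta ^+ (q - 2) |: B).
      apply/subsetP => x; rewrite !in_setU !in_set1 in_setC inE => xA.
      case: (eqVneq x 0) => //= x0; case: (lgP x) => -[h1 h2]; first by rewrite h1 eqxx in x0.
      case: eqVneq => //= nx; apply/imsetP.
      have lq : (lg x).+1 != (q - 2).+1.
        by apply: contra nx => /eqP[l]; rewrite h2 l.
      have lq' : ((lg x).+1 <= q - 2)%N by lia.
      have [/dvdnP[m em]|nd] := boolP (p %| (lg x).+1)%N.
        have m0 : (0 < m)%N by case: m em => // /eqP.
        have mr : (m < p ^ n.-1)%N by rewrite -(ltn_pmul2l p0) -qr mulnC -em; lia.
        have mb : (m.-1 < (p ^ n.-1).-1)%N by lia.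
        exists (Ordinal mb) => //=; rewrite {1}h2; congr (_ ^+ _).
        by case: m m0 em {mr mb} => //= m _; rewrite mulSn; lia.
      have fz : f (zeta * x) = e (lg x).+1 by rewrite {1}h2 -exprS fe.
      by move: xA; rewrite fz flg /e (counterS _ _ F_char) ?eqxx.
    have := subset_leq_card sA; rewrite !cardsU1.
    have := cardsC A; rewrite F_card.
    have : (#|B| <= (p ^ n.-1).-1)%N by rewrite (leq_trans (leq_imset_card _ _)) ?card_ord.
    by case: (_ \notin _); case: (_ \notin _); lia.
  have u2 : (p ^ (n - k) <= n + 2)%N.
    apply: (@subspace_card_le p) => //; first by rewrite leq_exp2l // leq_subr.
    by rewrite -q_def (leq_trans _ cA) // leq_mul2l cardA orbT.
  rewrite ler_pdivrMr ?ltr0n ?addn2 // -natrM ler_nat -addn2.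
  by rewrite -[X in (p ^ X)%N](subnKC kn) expnD leq_mul2l u2 orbT.
- move=> p2; rewrite /carlitz_rank; case: ex_minnP => k /asboolP wk _.
  have [a [b [c [d [D0 bad]]]]] := word_linear_fractional _ _ _ wk.
  (* The point 0 is removed because it is not the power of [zeta] given by its logarithm; it costs
     the 1 in [cS]. *)
  pose S := [set x : F | (x != 0) && (f x * (c * x + d) == a * x + b)].
  have cS : (q <= k + #|S| + 1)%N.
    have sC : ~: S \subset 0 |: [set x : F | perm f_inj x * (c * x + d) != a * x + b].
      apply/subsetP => x; rewrite !inE permE.
      by case: eqP.
    have := subset_leq_card sC; rewrite cardsU1.
    have := cardsC S; rewrite F_card.
    by case: (_ \notin _); lia.
  have := @card_fractional_agreement F p F_char n lambda zeta f lg a b c d S xlg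
    _ flg f_inj D0 _.
  rewrite -q_def => /(_ lgq) H.
  have {}H : (#|S| * #|S| <= 2 * (2 * p) ^ n + #|S|)%N.
    by apply: H => x; rewrite inE => /andP[x0 /eqP].
  set w := _ `^ _.
  have w0 : 0 <= w := powR_ge0 _ _.
  have ww : w * w = ((2 * p) ^ n)%:R.
    rewrite -expr2 -powR_mulrn // -powRrM divfK ?pnatr_eq0 //.
    by rewrite powR_mulrn ?ler0n // natrX.
  have w2 : 2 <= w.
    rewrite leNgt; apply/negP => wl.
    have : w * w < 4 by nra.
    rewrite ww ltr_nat; apply/negP; rewrite -leqNgt.
    rewrite -(prednK n_gt0) expnS (@leq_trans (2 * p)) ?leq_pmulr ?expn_gt0 ?muln_gt0 ?p0 //.
    by lia.
  have HR : #|S|%:R * #|S|%:R <= 2 * (w * w) + #|S|%:R :> R.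
    by rewrite ww -!natrM -natrD ler_nat.
  have := sqr_le_linear _ _ _ w2 HR.
  have : q%:R <= k%:R + #|S|%:R + 1 :> R by rewrite -natrD natr1 ler_nat -addn1.
  by lra.
Qed.
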